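(* Let $p\ge 1$, let $C_n$ be a cycle on $n$ vertices, let $\lambda$ be a $p$-periodic 1-labeling of $C_n$, and let $\mathcal{C}=(C_n,\lambda)$. Then $1\le M_p(\mathcal{C})\le 2$.
   Context: A $p$-periodic 1-labeling $\lambda$ of a finite simple undirected graph $G=(V,E)$ assigns to each edge $e$ an infinite set of time-steps of the form $\{i,i+p,i+2p,\dots\}$ with $i\in\{1,\dots,p\}$ (so each edge is present exactly once in every $p$ consecutive time-steps). In the temporal graph $\mathcal{G}=(G,\lambda)$, a journey from $u$ to $v$ is a path in $G$ from $u$ to $v$ together with a choice, for each edge of the path, of a time-step in its label set so that the chosen time-steps are strictly increasing along the path. The temporal distance $\mathrm{dist}_t(u,v)$ is the smallest time-step at which a journey from $u$ reaches $v$ (with $\mathrm{dist}_t(u,u)=0$, and $\infty$ if there is no journey). A set $R\subseteq V$ is a temporal resolving set if (i) for every $v\in V$ there is a journey from some $s\in R$ to $v$ (every vertex is reached from itself), and (ii) for every two distinct $u,v\in V$ there is $s\in R$ with $\mathrm{dist}_t(s,u)\neq\mathrm{dist}_t(s,v)$. $M_p(\mathcal{G})$ denotes the minimum size of a temporal resolving set of $\mathcal{G}$. *)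

(* Defs.v *)
From mathcomp Require Import all_boot.
From mathcomp Require Import boolp.

Set Implicit Arguments.
Unset Strict Implicit.
Unset Printing Implicit Defensive.

Record sgraph := SGraph {
  vertex :> finType;
  adj : rel vertex;
  adj_sym : symmetric adj;
  adj_irrefl : irreflexive adj }.

Section Cycle.

Variable n : nat.

Definition cycle_adj : rel 'I_n :=
  fun i j => (j == i.+1 %% n :> nat) || (i == j.+1 %% n :> nat).

Lemma cycle_adj_sym : symmetric cycle_adj.
Proof. by move=> i j; rewrite /cycle_adj orbC. Qed.

Lemma cycle_adj_irrefl : 2 < n -> irreflexive cycle_adj.
Proof.
move=> n3 i; rewrite /cycle_adj orbb; apply/negbTE.
have := ltn_ord i; rewrite leq_eqVlt => /orP[/eqP e | lt].
  by rewrite e modnn; apply/eqP => i0; move: e n3; rewrite i0 => <-.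
by rewrite modn_small // ltn_eqF.
Qed.

Definition cycle_graph (n3 : 2 < n) : sgraph :=
  SGraph cycle_adj_sym (cycle_adj_irrefl n3).

End Cycle.

Section TemporalGraph.

Variable G : sgraph.

(* The edge between x and y is the set [set x; y]; the time-steps given to
   other sets of vertices are never used. *)
Definition labeling := {set G} -> nat -> Prop.

Definition periodic_1labeling (p : nat) (lam : labeling) : Prop :=
  forall x y : G, adj x y ->
    exists2 i : nat, 1 <= i <= p &
      forall t : nat, lam [set x; y] t <-> exists k : nat, t = i + k * p.

Variable lam : labeling.

(* u :: q lists the visited vertices, u included; ts the crossing times. *)
Definition is_journey (u v : G) (q : seq G) (ts : seq nat) : Prop :=
  [/\ path (@adj G) u q, uniq (u :: q) & last u q = v] /\
  [/\ size ts = size q, sorted ltn ts &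
      forall k : nat, k < size q ->
        lam [set nth u (u :: q) k; nth u (u :: q) k.+1] (nth 0 ts k)].

(* The empty journey from u to u arrives at time-step 0. *)
Definition arrives (u v : G) (t : nat) : Prop :=
  exists q ts, is_journey u v q ts /\ t = last 0 ts.

Definition reaches (u v : G) : Prop := exists q ts, is_journey u v q ts.

(* None stands for infinity. *)
Definition dist_t (u v : G) : option nat :=
  match pselect (exists t : nat, `[< arrives u v t >]) with
  | left ex_t => Some (ex_minn ex_t)
  | right _ => None
  end.

Definition temporal_resolving (R : {set G}) : Prop :=
  (forall v : G, exists2 s, s \in R & reaches s v) /\
  (forall u v : G, u != v -> exists2 s, s \in R & dist_t s u <> dist_t s v).

(* The default value [set: G] is itself resolving when time-steps are
   positive, see temporal_resolving_setT. *)
Definition temporal_metric_dim : nat :=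
  #|[arg min_(R < [set: G] | `[< temporal_resolving R >]) #|R| ]|.

Lemma reaches_refl u : reaches u u.
Proof. by exists [::], [::]. Qed.

Lemma dist_t_refl u : dist_t u u = Some 0.
Proof.
have a0 : `[< arrives u u 0 >] by apply/asboolP; exists [::], [::].
rewrite /dist_t; case: pselect => [ex_t|[]]; last by exists 0.
by case: ex_minnP => m _ /(_ 0 a0); rewrite leqn0 => /eqP->.
Qed.

Lemma temporal_resolving_setT :
  (forall x y : G, adj x y -> ~ lam [set x; y] 0) ->
  temporal_resolving [set: G].
Proof.
move=> pos; split=> [v|u v uv]; first by exists v => //; exact: reaches_refl.
exists u => //; rewrite dist_t_refl /dist_t; case: pselect => // ex_t [].
case: ex_minnP => m /asboolP[q [ts [[[pq _ lq] [sz so al]] ->]]] _ l0.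
case: q pq lq sz al => [|x q] /=; first by move=> _ e; rewrite e eqxx in uv.
move=> /andP[ux _] _; case: ts so l0 => // t ts /= so l0 _ /(_ 0 isT) /= tl.
apply: (pos _ _ ux); suff -> : 0 = t by [].
case: ts so l0 => //= t' ts /andP[tt' so] l0.
have := order_path_min ltn_trans so => /allP al.
have : last t' ts \in t' :: ts by exact: mem_last.
rewrite -l0 inE => /orP[/eqP e|/al //].
by rewrite -e in tt'.
Qed.

Lemma periodic_temporal_resolving_setT (p : nat) :
  periodic_1labeling p lam -> temporal_resolving [set: G].
Proof.
move=> per; apply: temporal_resolving_setT => x y /per[i /andP[i1 _] lamE].
by move=> /lamE[k] e; move: i1; rewrite lt0n; case: i {lamE} e.
Qed.

End TemporalGraph.

(* Main.v *)
(* Let ab be an edge of largest label; then {a, b} is resolving. An earliest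
   journey through ab crosses it at its label, which is too late for the first
   label of the following edge, so from then on it runs exactly p steps behind
   the journey started at the other end of ab. Hence, if x and y are the
   arrival times at a vertex other than a and b of the earliest journeys
   avoiding ab that start at b and at a respectively, the distances from a and
   b to that vertex are min (x + p, y) and min (x, y + p). Along the path from
   b to a avoiding ab, x increases and y decreases strictly, so two vertices
   (x, y) and (x', y') with equal distances, x < x', would satisfy both
   x + p = y' and x = y' + p. *)
Require Import Defs.
From mathcomp Require Import all_boot.
From mathcomp Require Import boolp zify.

Set Implicit Arguments.
Unset Strict Implicit.
Unset Printing Implicit Defensive.

(** * Greedy crossing of periodically available edges *)

Section Greedy.

Variable p : nat.
Hypothesis p_gt0 : 0 < p.

(** The least term of the progression [l], [l + p], [l + 2 * p], ... exceeding [t]. *)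
Definition next_time (t l : nat) : nat :=
  l + (if t < l then 0 else ((t - l) %/ p).+1) * p.

Lemma next_time_gt t l : t < next_time t l.
Proof.
rewrite /next_time; case: (ltnP t l) => [|lt]; first by lia.
by rewrite -ltn_subLR // ltn_ceil.
Qed.

Lemma next_time_min t l k : t < l + k * p -> next_time t l <= l + k * p.
Proof.
rewrite /next_time; case: (ltnP t l) => [|lt] tk; first by lia.
by rewrite leq_add2l leq_mul2r ltn_divLR // orbC; apply/orP; left; lia.
Qed.

Lemma next_time_mono t t' l : t <= t' -> next_time t l <= next_time t' l.
Proof.
by move=> tt'; apply/next_time_min/(leq_ltn_trans tt')/next_time_gt.
Qed.

Lemma next_time_shift t l : l <= p -> next_time (t + p) l = next_time t l + p.
Proof.
move=> lp; rewrite /next_time ltnNge (leq_trans lp (leq_addl _ _)) /=.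
case: (ltnP t l) => lt; first by rewrite divn_small; lia.
by rewrite -addnBAC // divnDr // divnn p_gt0; lia.
Qed.

(** Arrival time of a traveller at time [t] who crosses [j] edges, of labels [L k], [L k.+1], ...,
    each as early as possible. *)
Fixpoint greedy (L : nat -> nat) (t k j : nat) : nat :=
  if j is j'.+1 then greedy L (next_time t (L k)) k.+1 j' else t.

Variable L : nat -> nat.

Lemma greedy_mono t t' k j : t <= t' -> greedy L t k j <= greedy L t' k j.
Proof.
by elim: j t t' k => //= j IH t t' k tt'; apply/IH/next_time_mono.
Qed.

Lemma greedyS_gt t k j : greedy L t k j < greedy L t k j.+1.
Proof. elim: j t k => [|j IH] t k; [exact: next_time_gt | exact: IH]. Qed.

Lemma greedy_incr t k : {homo greedy L t k : i j / i < j}.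
Proof. by apply: homo_ltn => [|j]; [exact: ltn_trans|exact: greedyS_gt]. Qed.

Lemma greedy_shift t k j :
  (forall i, L i <= p) -> greedy L (t + p) k j = greedy L t k j + p.
Proof.
by move=> Lp; elim: j t k => //= j IH t k; rewrite next_time_shift // IH.
Qed.

(** The first edge is crossed at time [L k]. As [L k.+1 <= L k < L k.+1 + p], the next one is
    crossed at [L k.+1 + p], and [greedy_shift] carries this delay of [p] to the end. *)
Lemma greedy_delay k j : (forall i, 0 < L i <= p) -> L k.+1 <= L k ->
  greedy L 0 k j.+2 = greedy L 0 k.+1 j.+1 + p.
Proof.
move=> Lp Lk /=; rewrite -greedy_shift => [|i]; last by case/andP: (Lp i).
have /andP[k0 kp] := Lp k; have /andP[k10 k1p] := Lp k.+1.
congr greedy; rewrite {1 3}/next_time k10 /next_time k0 ltnNge addn0 Lk /=.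
by rewrite divn_small; lia.
Qed.

(** Waiting never helps: an admissible first crossing is no earlier than [next_time], and [greedy]
    is monotone in its starting time. *)
Lemma greedy_min t k ts : path ltn t ts ->
  (forall i, i < size ts -> exists m, nth 0 ts i = L (k + i) + m * p) ->
  greedy L t k (size ts) <= last t ts.
Proof.
elim: ts t k => //= t1 ts IH t k /andP[tt1 pts] Lts.
have [m /= e] := Lts 0 isT.
apply: leq_trans (IH t1 k.+1 pts _); last first.
  by move=> i /(Lts i.+1); rewrite addnS.
by apply: greedy_mono; rewrite addn0 in e; rewrite e next_time_min // -e.
Qed.

Lemma greedy_attained t k j : exists ts, [/\ size ts = j, path ltn t ts,
  forall i, i < j -> exists m, nth 0 ts i = L (k + i) + m * p &
  last t ts = greedy L t k j].
Proof.
elim: j t k => [|j IH] t k; first by exists [::].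
have [ts [sz pts Lts lts]] := IH (next_time t (L k)) k.+1.
exists (next_time t (L k) :: ts); split=> //=; first by rewrite sz.
  by rewrite next_time_gt.
case=> [_|i]; last by move=> /Lts; rewrite addSnnS.
by rewrite addn0; eexists; reflexivity.
Qed.

End Greedy.

(** * Walks around a cycle in both directions *)

Section Turn.

Variables (G : sgraph) (n : nat).

(** The last clause excludes other neighbours, so a path along [c] can only advance or step back. *)
Definition turn (c : nat -> G) : Prop :=
  [/\ forall i j, (c i == c j) = (i == j %[mod n]),
      forall k, adj (c k) (c k.+1) &
      forall k z, adj (c k.+1) z -> z = c k \/ z = c k.+2].

(* The turn k |-> c (1 - k), with n.-1 standing for -1 modulo n. *)
Definition rev_turn (c : nat -> G) (k : nat) : G := c (n.-1 * k).+1.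

Lemma mul_predn k : 0 < n -> n.-1 * k + k = k * n.
Proof. by move=> n0; rewrite -mulSnr prednK // mulnC. Qed.

Lemma turn_modn c i j : turn c -> i = j %[mod n] -> c i = c j.
Proof. by case=> cE _ _ ij; apply/eqP; rewrite cE ij. Qed.

Lemma rev_turnE c i j : 0 < n -> turn c -> i + j = 1 %[mod n] ->
  rev_turn c i = c j.
Proof.
move=> n0 tc ij; apply: (turn_modn tc).
apply/eqP; rewrite -(eqn_modDr i) [j + i]addnC ij addSn.
by rewrite mul_predn // -addn1 modnMDl.
Qed.

Lemma rev_turnP c : 0 < n -> turn c -> turn (rev_turn c).
Proof.
move=> n0 tc; have mulE k := mul_predn k n0.
(* With [m = n.-1 * k.+1], the reversed walk is at [c m.+2], [c m.+1], [c m] at indices [k], [k.+1],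
   [k.+2]. *)
have revS k : rev_turn c k = c (n.-1 * k.+1).+2.
  by apply: (turn_modn tc); rewrite -(modnDr _.+1); congr (_ %% _); nia.
have revSS k : rev_turn c k.+2 = c (n.-1 * k.+1).
  by apply: (turn_modn tc); rewrite -[RHS]modnDr; congr (_ %% _); nia.
have [cE cadj cnext] := tc; split=> [i j|k|k z].
- rewrite /rev_turn cE -(eqn_modDr (i + j)).
  have -> : (n.-1 * i).+1 + (i + j) = i * n + j.+1 by rewrite -mulE; lia.
  have -> : (n.-1 * j).+1 + (i + j) = j * n + i.+1 by rewrite -mulE; lia.
  by rewrite !modnMDl -addn1 -(addn1 i) eqn_modDr eq_sym.
- by rewrite revS adj_sym /rev_turn cadj.
- by rewrite (revS k) revSS => /cnext[]->; [right|left].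
Qed.

End Turn.

(** * Earliest journeys and temporal distances along turns *)

Section Journeys.

Variables (G : sgraph) (n p : nat) (lam : labeling G) (lab : {set G} -> nat).
Hypotheses (n_gt0 : 0 < n) (p_gt0 : 0 < p).
Hypothesis labP : forall x y : G, adj x y -> 0 < lab [set x; y] <= p /\
  forall t, lam [set x; y] t <-> exists k, t = lab [set x; y] + k * p.

Definition turn_label (c : nat -> G) (k : nat) : nat := lab [set c k; c k.+1].

Lemma dist_t_eq (u v : G) t : arrives lam u v t ->
  (forall t', arrives lam u v t' -> t <= t') -> dist_t lam u v = Some t.
Proof.
move=> tP tmin; rewrite /dist_t; case: pselect => [ex_t|[]]; last first.
  by exists t; apply/asboolP.
case: ex_minnP => m /asboolP mP /(_ t) mt; congr Some; apply/eqP.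
by rewrite eqn_leq tmin // andbT mt //; apply/asboolP.
Qed.

Section OneTurn.

Variable c : nat -> G.
Hypothesis tc : turn n c.

Lemma turn_label_bounds k : 0 < turn_label c k <= p.
Proof. by have [_ cadj _] := tc; have [] := labP (cadj k). Qed.

Lemma turn_uniq k j : uniq (map c (iota k j)) = (j <= n).
Proof.
have [cE _ _] := tc; case: (leqP j n) => jn; last first.
  apply/negbTE/(uniqPn (c 0)); exists 0, n; rewrite size_map size_iota.
  rewrite !(nth_map 0) ?size_iota ?nth_iota; try lia.
  by split=> //; apply: (turn_modn tc); rewrite addn0 modnDr.
rewrite map_inj_in_uniq ?iota_uniq // => x y; rewrite !mem_iota.
move=> /andP[kx xk] /andP[ky yk] /eqP; rewrite cE.
rewrite -(subnKC kx) -(subnKC ky) eqn_modDl !modn_small; try lia.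
Qed.

Lemma map_turn_path k j : path (@adj G) (c k) (map c (iota k.+1 j)).
Proof.
have [_ cadj _] := tc.
by elim: j k => //= j IH k; rewrite cadj IH.
Qed.

(** With [c k] excluded and no vertex repeated, every step is forced forward. *)
Lemma path_turn k q : path (@adj G) (c k.+1) q -> uniq (c k.+1 :: q) ->
  c k \notin q -> q = map c (iota k.+2 (size q)).
Proof.
have [_ _ cnext] := tc; elim: q k => //= z q IH k /andP[/cnext[]-> pq].
  by move=> _; rewrite inE eqxx.
by rewrite !(inE, negb_or) => /andP[/andP[_ ckq] uq] _; rewrite -IH.
Qed.

Lemma map_turn_journey k j ts : j < n ->
  size ts = j -> path ltn 0 ts ->
  (forall i, i < j -> exists m, nth 0 ts i = turn_label c (k + i) + m * p) ->
  is_journey lam (c k) (c (k + j)) (map c (iota k.+1 j)) ts.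
Proof.
have [_ cadj _] := tc; move=> jn sz pts Lts; split; split.
- exact: map_turn_path.
- by rewrite -[_ :: _]/(map c (iota k j.+1)) turn_uniq.
- by rewrite last_map -nth_last size_iota; case: j {jn sz Lts} => [|j];
    rewrite ?addn0 // nth_iota // addSnnS.
- by rewrite size_map size_iota.
- exact: path_sorted pts.
rewrite size_map size_iota -[_ :: _]/(map c (iota k j.+1)) => i ij.
rewrite !(nth_map 0) ?size_iota ?nth_iota; try lia.
by have [_ labE] := labP (cadj (k + i)); rewrite addnS; apply/labE/Lts.
Qed.

Lemma arrives_turn k j : j < n ->
  arrives lam (c k) (c (k + j)) (greedy p (turn_label c) 0 k j).
Proof.
move=> jn; have [ts [sz pts Lts <-]] :=
  greedy_attained p_gt0 (turn_label c) 0 k j.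
by exists (map c (iota k.+1 j)), ts; split=> //; apply: map_turn_journey.
Qed.

(** The first step fixes the direction, hence the whole path by [path_turn]; distinctness of its
    vertices bounds its length. *)
Lemma turn_journey_min k v q ts : is_journey lam (c k) v (c k.+1 :: q) ts ->
  exists j, [/\ 0 < j < n, v = c (k + j) &
    greedy p (turn_label c) 0 k j <= last 0 ts].
Proof.
have [_ cadj _] := tc; case=> -[/andP[_ pq] uq lq] [sz so Lts].
have /= /andP[] := uq; rewrite inE negb_or => /andP[_ ckq] uq'.
have qE : c k.+1 :: q = map c (iota k.+1 (size q).+1).
  by rewrite /= -path_turn.
exists (size q).+1; split.
- by move: uq; rewrite qE -[_ :: _]/(map c (iota k (size q).+2)) turn_uniq.
- rewrite -lq qE last_map -nth_last size_iota nth_iota //; congr c; lia.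
have nthE i : i <= (size q).+1 -> nth (c k) [:: c k, c k.+1 & q] i = c (k + i).
  move=> iq; rewrite qE -[_ :: _]/(map c (iota k (size q).+2)).
  by rewrite (nth_map 0) ?size_iota ?nth_iota.
have {}Lts i : i < size ts ->
    exists m, nth 0 ts i = turn_label c (k + i) + m * p.
  rewrite sz => /[dup] iq /Lts; rewrite !nthE ?(ltnW iq) //.
  by have [_ labE] := labP (cadj (k + i)); rewrite addnS => /labE.
rewrite -[_.+1]/(size (c k.+1 :: q)) -sz; apply: greedy_min => //.
(* Labels are positive, so the first crossing comes after time 0. *)
case: ts so sz Lts => //= t ts -> _ /(_ 0 isT)[m /= ->].
by have := turn_label_bounds (k + 0); lia.
Qed.

End OneTurn.

Section TwoTurns.

Variables c c' : nat -> G.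
Hypotheses (tc : turn n c) (tc' : turn n c').
Hypothesis cc' : forall i j, i + j = 1 %[mod n] -> c i = c' j.

(** The first edge leads to [c 1 = c' 0] or to [c' 2], which commits the journey to [j] edges along
    [c] or [n - j] edges along [c']. The latter start at index 1 because [c 0 = c' 1]. *)
Lemma dist_turn j : 0 < j < n -> dist_t lam (c 0) (c j) =
  Some (minn (greedy p (turn_label c) 0 0 j)
             (greedy p (turn_label c') 0 1 (n - j))).
Proof.
move=> /andP[j0 jn]; have n1 : 1 < n by lia.
have c01 : c 0 = c' 1 by exact: cc'.
have cj : c j = c' (1 + (n - j)).
  by apply: cc'; rewrite addnCA subnKC ?(ltnW jn) // modnDr.
apply: dist_t_eq => [|t [q [ts [J ->]]]].
  rewrite /minn; case: ifP => _.
    by have := arrives_turn tc 0 jn; rewrite add0n.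
  by rewrite c01 cj; apply: arrives_turn => //; lia.
have [_ _ cnext] := tc'.
have [cE _ _] := tc; have [cE' _ _] := tc'.
case: q J => [|z q] J.
  by have [[_ _ /= /eqP e] _] := J; move: e;
    rewrite cE mod0n modn_small // ltn_eqF.
have [[/= /andP[zc _] _ _] _] := J.
move: (zc); rewrite c01 => /cnext[] zE; rewrite {}zE in J zc.
  move: J; rewrite -(@cc' 1 0) //.
  move=> /(turn_journey_min tc)[i [/andP[_ ni] /eqP]]; rewrite cE add0n !modn_small //
    => /eqP -> le_t.
  by rewrite geq_min le_t.
move: J; rewrite c01 => /(turn_journey_min tc')[i [/andP[_ ni] /eqP]].
rewrite cj cE' eqn_modDl !modn_small //; last by rewrite ltn_subrL j0.
by move=> /eqP -> le_t; rewrite geq_min le_t orbT.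
Qed.

End TwoTurns.

Lemma turn_resolving (c : nat -> G) :
  turn n c -> (forall v, exists i, v = c i) ->
  (forall k, turn_label c k <= turn_label c 0) ->
  temporal_resolving lam [set c 0; c 1].
Proof.
move=> tc csurj lab_max; set c' := rev_turn n c.
have tc' : turn n c' by exact: rev_turnP.
have c'c i j : i + j = 1 %[mod n] -> c' i = c j by exact: rev_turnE.
have cc' i j : i + j = 1 %[mod n] -> c i = c' j.
  by move=> ij; apply/esym/c'c; rewrite addnC.
have c'0 : c' 0 = c 1 by exact: c'c.
have c'1 : c' 1 = c 0 by exact: c'c.
(* This is the hypothesis of [greedy_delay] for the reversed direction. *)
have lab_c' : turn_label c' 1 <= turn_label c' 0.
  rewrite {2}/turn_label c'0 c'1 setUC -/(turn_label c 0).
  have -> : turn_label c' 1 = turn_label c n.-1; last exact: lab_max.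
  rewrite /turn_label prednK // setUC (c'c 2 n.-1) ?(c'c 1 n) ?modnDr //.
  by rewrite addSnnS prednK // modnDr.
have surj v : exists2 i, i < n & v = c i.
  have [i ->] := csurj v; exists (i %% n); first by rewrite ltn_mod.
  by apply: (turn_modn tc); rewrite modn_mod.
(* Earliest arrivals at [c j] avoiding the edge between [c 0] and [c 1]: [x] forward from [c 1], [y]
   backward from [c 0]. *)
pose x j := greedy p (turn_label c) 0 1 j.-1.
pose y j := greedy p (turn_label c') 0 1 (n - j).
have distE j : 1 < j < n ->
    dist_t lam (c 0) (c j) = Some (minn (x j + p) (y j)).
  move=> /andP[j1 jn]; rewrite (dist_turn tc tc' cc') ?jn ?(ltnW j1) //.
  case: j j1 jn => [|[|j]] // _ jn.
  by rewrite greedy_delay //; exact: turn_label_bounds.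
have distE' j : 1 < j < n ->
    dist_t lam (c 1) (c j) = Some (minn (y j + p) (x j)).
  (* Exchange the directions: the source is [c' 0], and [c j] has index [n.+1 - j] on [c']. *)
  move=> /andP[j1 jn]; rewrite -(c'c 0 1) // -(c'c (n.+1 - j) j); last first.
    by rewrite subnK ?(leqW (ltnW jn)) // -(add1n n) modnDr.
  rewrite (dist_turn tc' tc c'c); last by lia.
  have -> : n - (n.+1 - j) = j.-1 by lia.
  rewrite /y (_ : n.+1 - j = (n - j.+1).+2); last by lia.
  rewrite greedy_delay //; last exact: turn_label_bounds.
  by rewrite (_ : n - j = (n - j.+1).+1) //; lia.
have x_incr i j : 0 < i -> i < j -> x i < x j.
  by move=> i0 ij; apply: greedy_incr => //; lia.
have y_decr i j : i < j -> j < n -> y j < y i.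
  by move=> ij jn; apply: greedy_incr => //; lia.
split=> [v|u v].
  have [i ni ->] := surj v; exists (c 0); first by rewrite !inE eqxx.
  by have [q [ts [J _]]] := arrives_turn tc 0 ni; exists q, ts.
have [i ni ->] := surj u; have [j nj ->] := surj v.
wlog ij : i j ni nj / i < j.
  move=> W; case: (ltngtP i j) => [ij|ji|->]; [exact: W| |by rewrite eqxx].
  by rewrite eq_sym => /(W _ _ nj ni ji)[s sR ds]; exists s => // /esym.
(* For [i = 0] or [i = 1], [c i] lies in the resolving set and is the only vertex at distance 0 from
   itself. *)
move=> _; case: i ij {ni} => [|[|i]] ij.
- exists (c 0); first by rewrite !inE eqxx.
  rewrite dist_t_refl (dist_turn tc tc' cc') ?ij // => -[].
  have yj : 0 < n - j by rewrite subn_gt0.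
  have := greedy_incr p_gt0 (turn_label c') 0 1 yj.
  have := greedy_incr p_gt0 (turn_label c) 0 0 ij; rewrite /=; lia.
- exists (c 1); first by rewrite !inE eqxx orbT.
  rewrite dist_t_refl distE' ?ij // => -[].
  have : 0 < x j by exact: (x_incr 1 j).
  lia.
have := x_incr i.+2 j isT ij; have := y_decr _ _ ij nj.
(* If neither source separates the vertices, the minima force [x i.+2 + p = y j] and
   [x i.+2 = y j + p], impossible as [p > 0]. *)
have [dE|dN] := eqVneq (dist_t lam (c 0) (c i.+2)) (dist_t lam (c 0) (c j)).
  exists (c 1); first by rewrite !inE eqxx orbT.
  move: dE; rewrite !distE ?distE' ?nj ?(ltn_trans ij nj) ?(leq_trans _ ij) //.
  by move=> [e] [e']; lia.
by exists (c 0); [rewrite !inE eqxx | apply/eqP].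
Qed.

End Journeys.

(** * Application to the cycle graph *)

Lemma turn_cycle n (hn : 2 < n) (m : nat) :
  turn n (fun k =>
    Ordinal (ltn_pmod (m + k) (ltnW (ltnW hn))) : cycle_graph hn).
Proof.
split=> [i j|k|k z].
- by rewrite -val_eqE /= eqn_modDl.
- by rewrite /= /cycle_adj /= -(addn1 (_ %% n)) modnDml addn1 addnS eqxx.
rewrite /= /cycle_adj /= => /orP[]/eqP e; [right|left]; apply: val_inj => /=.
  by rewrite e -(addn1 (_ %% n)) modnDml addn1 !addnS.
move/eqP: e; rewrite addnS -addn1 -(addn1 z) eqn_modDr eq_sym => /eqP.
by rewrite modn_small.
Qed.

Theorem theorem12 (p n : nat) (hp : 1 <= p) (hn : 2 < n)
    (lam : labeling (cycle_graph hn))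
    (hlam : periodic_1labeling p lam) :
  1 <= temporal_metric_dim lam <= 2.
Proof.
have n0 : 0 < n by lia.
have [lab labP] : exists lab : {set cycle_graph hn} -> nat,
    forall x y, adj x y -> 0 < lab [set x; y] <= p /\
    forall t, lam [set x; y] t <-> exists k, t = lab [set x; y] + k * p.
  (* Choosing per vertex set makes the label independent of the orientation of the edge; sets that
     are not edges get 0. *)
  have /choice[lab labP] : forall e : {set cycle_graph hn}, exists l,
      forall x y, adj x y -> e = [set x; y] ->
      0 < l <= p /\ forall t, lam e t <-> exists k, t = l + k * p.
    move=> e; have [[x [y [xy ->]]]|no] := pselect (exists x y,
        adj x y /\ e = [set x; y]).
      by have [l lp lE] := hlam x y xy; exists l => x' y' _ e'.
    by exists 0 => x y xy ex; case: no; exists x, y.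
  by exists lab => x y xy; apply: (labP _ x y xy).
pose c m k : cycle_graph hn := Ordinal (ltn_pmod (m + k) (ltnW (ltnW hn))).
have tc m : turn n (c m) by exact: turn_cycle.
(* The walk is rotated so that its first edge has the largest label; edge [k] from [m] is edge 0
   from [m + k]. *)
pose m := [arg max_(m > Ordinal n0) turn_label lab (c m) 0].
have lab_max k : turn_label lab (c m) k <= turn_label lab (c m) 0.
  rewrite /m; case: arg_maxnP => // i _.
  move=> /(_ (Ordinal (ltn_pmod (i + k) n0)) isT).
  congr (_ <= _); congr lab; congr [set _; _]; apply: val_inj => /=.
    by rewrite addn0 modn_mod.
  by rewrite modnDml addn1 addnS.
have res : temporal_resolving lam [set c m 0; c m 1].
  apply: (turn_resolving n0 hp labP (tc m) _ lab_max) => v.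
  exists (n - m + v); apply: val_inj => /=.
  by rewrite addnA subnKC ?(ltnW (ltn_ord m)) // modnDl modn_small.
(* The first goal is that the default set of the minimum is resolving. Then the pair above gives the
   upper bound, and covering a vertex makes [R] nonempty. *)
rewrite /temporal_metric_dim; case: arg_minnP => [|R /asboolP[cov _] Rmin].
  exact/asboolP/periodic_temporal_resolving_setT/hlam.
apply/andP; split; last first.
  by apply: leq_trans (Rmin _ (asboolT res)) _; rewrite cards2; case: eqP.
by have [s sR _] := cov (c 0 0); apply/card_gt0P; exists s.
Qed.
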